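(* Let $m\geq 1$ and $n\geq 3$ be integers. The graph $\overline{K_m}\nabla C_n$ (on $m+n$ vertices) is $D$-integral if and only if $(m,n)$ is one of $(1,3)$, $(4,3)$, $(2,4)$, $(4,6)$, $(12,6)$.
   Context: All graphs are finite, simple and connected. $\overline{K_m}$ is the edgeless graph on $m$ vertices and $C_n$ the cycle on $n$ vertices. For graphs $G_1,G_2$, the join $G_1\nabla G_2$ is obtained from the disjoint union $G_1\cup G_2$ by adding all edges between a vertex of $G_1$ and a vertex of $G_2$. The distance matrix $D(G)$ of a connected graph $G$ has as $(i,j)$-entry the length of a shortest path between $v_i$ and $v_j$. A graph $G$ is $D$-integral if all eigenvalues of $D(G)$ are integers. *)

(* Defs.v *)
From HB Require Import structures.
From mathcomp Require Import all_boot all_order all_algebra all_field.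

Set Implicit Arguments.
Unset Strict Implicit.
Unset Printing Implicit Defensive.

Import Order.TTheory GRing.Theory Num.Theory.

Record sgraph := SGraph {
  vertex :> finType;
  adj : rel vertex;
  adj_sym : symmetric adj;
  adj_irr : irreflexive adj }.

Definition connected (G : sgraph) : Prop :=
  forall x y : G, connect (@adj G) x y.

Definition has_path (G : sgraph) (x y : G) (k : nat) : bool :=
  [exists p : k.-tuple G,
    [&& path (@adj G) x p, last x p == y & uniq (x :: p)]].

(* A path has at most #|G| - 1 edges, so the search over k < #|G| finds the
   length of a shortest one; the value is the junk #|G| when none exists. *)
Definition dist (G : sgraph) (x y : G) : nat :=
  find (has_path x y) (iota 0 #|G|).

Definition distance_matrix (G : sgraph) : 'M[algC]_#|G| :=
  \matrix_(i, j) ((dist (enum_val i) (enum_val j))%:R)%R.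

(* The distance matrix has integer entries, so its complex eigenvalues are all
   algebraic and nothing is lost by taking them in algC. *)
Definition D_integral (G : sgraph) : Prop :=
  forall a : algC, eigenvalue (distance_matrix G) a -> a \is a Num.int.

Section Edgeless.
Variable m : nat.
Definition edgeless_adj : rel 'I_m := fun _ _ => false.
Lemma edgeless_sym : symmetric edgeless_adj. Proof. by []. Qed.
Lemma edgeless_irr : irreflexive edgeless_adj. Proof. by []. Qed.
Definition edgeless_graph := SGraph edgeless_sym edgeless_irr.
End Edgeless.

Section Cycle.
Variable n : nat.
(* The conjunct i != j only matters for n = 1, where ordS i = i. *)
Definition cycle_adj : rel 'I_n :=
  fun i j => (i != j) && ((j == ordS i) || (i == ordS j)).
Lemma cycle_sym : symmetric cycle_adj.
Proof. by move=> i j; rewrite /cycle_adj eq_sym orbC. Qed.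
Lemma cycle_irr : irreflexive cycle_adj.
Proof. by move=> i; rewrite /cycle_adj eqxx. Qed.
Definition cycle_graph := SGraph cycle_sym cycle_irr.
End Cycle.

Section Join.
Variables G1 G2 : sgraph.
Definition join_adj : rel (G1 + G2)%type := fun u v =>
  match u, v with
  | inl x, inl y => adj x y
  | inr x, inr y => adj x y
  | _, _ => true
  end.
Lemma join_sym : symmetric join_adj.
Proof. by move=> [x|x] [y|y] //=; apply: adj_sym. Qed.
Lemma join_irr : irreflexive join_adj.
Proof. by move=> [x|x] /=; apply: adj_irr. Qed.
Definition join_graph := SGraph join_sym join_irr.
End Join.

Lemma dist_shortest (G : sgraph) (x y : G) : connected G ->
  has_path x y (dist x y) /\ forall k, has_path x y k -> dist x y <= k.
Proof.
have small k : has_path x y k -> k < #|G|.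
  case/existsP=> p /and3P[_ _ /card_uniqP cp].
  by have := max_card [in x :: p]; rewrite cp /= size_tuple.
move=> /(_ x y) /connectP[p0 /shortenP[p pp up _] yE].
have hp : has_path x y (size p).
  by apply/existsP; exists (in_tuple p); rewrite pp up yE eqxx.
have hs : has (has_path x y) (iota 0 #|G|).
  by apply/hasP; exists (size p) => //; rewrite mem_iota /= small.
have lt : dist x y < #|G| by rewrite /dist -[X in _ < X](size_iota 0) -has_find.
split; first by have := nth_find 0 hs; rewrite nth_iota.
move=> k hk; rewrite leqNgt; apply/negP => ltk.
by have := before_find 0 ltk; rewrite nth_iota ?hk // (ltn_trans ltk).
Qed.

Lemma join_connected (G1 G2 : sgraph) :
  0 < #|G1| -> 0 < #|G2| -> connected (join_graph G1 G2).
Proof.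
case/card_gt0P=> a _ /card_gt0P[b _] [x|x] [y|y].
- by apply: (connect_trans (y := inr b)); apply: connect1.
- exact: connect1.
- exact: connect1.
- by apply: (connect_trans (y := inl a)); apply: connect1.
Qed.

(* Main.v *)
Require Import Defs.
From mathcomp Require Import all_boot all_order all_algebra all_field.
From mathcomp Require Import zify ring.

(* The join has diameter at most 2, so the spectrum of its distance matrix is
   explicit: besides [-2], it consists of the values [- 2 - (z + z^-1)] for the
   nontrivial [n]-th roots of unity [z] (vectors supported on the cycle with
   zero sum) and the two roots of
     [(a - (2 m - 2)) (a - (2 n - 4)) = m n]
   (vectors constant on both parts). If [z + z^-1] is an integer for a primitive
   [z], then it lies between [-2] and [2], which forces [n] to be 3, 4 or 6; the
   quadratic has integer roots exactly when [(m - n + 1)^2 + m n] is a square,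
   which leaves finitely many [m] for each of these [n]. *)

Set Implicit Arguments.
Unset Strict Implicit.
Unset Printing Implicit Defensive.

Import Order.TTheory GRing.Theory Num.Theory.

(** * Distances in graphs of diameter at most 2 *)

Lemma has_path0 (G : sgraph) (x y : G) : has_path x y 0 = (x == y).
Proof.
apply/existsP/eqP => [[p]|->]; last by exists [tuple]; rewrite /= eqxx.
by rewrite tuple0 /= andbT => /eqP.
Qed.

Lemma has_path1 (G : sgraph) (x y : G) : has_path x y 1 = adj x y.
Proof.
apply/existsP/idP => [[p]|xy].
  case/tupleP: p => z p; rewrite tuple0 /= andbT.
  by case/and3P=> xz /eqP <-.
exists [tuple y]; rewrite /= xy eqxx inE !andbT.
by apply: contraTneq xy => ->; rewrite adj_irr.
Qed.

Lemma has_path2 (G : sgraph) (x y z : G) :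
  x != y -> adj x z -> adj z y -> has_path x y 2.
Proof.
move=> xy xz zy; apply/existsP; exists [tuple z; y].
rewrite /= xz zy eqxx !inE negb_or xy !andbT /=.
apply/andP; split; first by apply: contraTneq xz => ->; rewrite adj_irr.
by apply: contraTneq zy => ->; rewrite adj_irr.
Qed.

(** The search in [dist] only tries lengths below [#|G|], so [2 < #|G|] ensures that length 2 is
    tried. *)
Lemma dist_diameter2 (G : sgraph) (x y : G) : 2 < #|G| ->
    (x != y -> ~~ adj x y -> exists2 z, adj x z & adj z y) ->
  dist x y = if x == y then 0 else if adj x y then 1 else 2.
Proof.
rewrite /dist; case: #|G| => [|[|[|k]]] //= _ mid.
rewrite has_path0 has_path1.
case: ifPn => // xy; case: ifPn => // nxy.
by have [z xz zy] := mid xy nxy; rewrite (has_path2 xy xz zy).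
Qed.

Lemma dist_join (G1 G2 : sgraph) (x y : join_graph G1 G2) :
    0 < #|G1| -> 0 < #|G2| -> 2 < #|G1| + #|G2| ->
  dist x y = if x == y then 0 else if adj x y then 1 else 2.
Proof.
case/card_gt0P=> a _ /card_gt0P[b _] G3.
apply: dist_diameter2; first by rewrite card_sum.
by case: x y => [x|x] [y|y] //= _ _; [exists (inr b) | exists (inl a)].
Qed.

(** * The two neighbours of a vertex on a cycle *)

Section CycleNeighbours.
Variables (n : nat) (hn : 2 < n).

Lemma ordS_neq (i : 'I_n) : ordS i != i.
Proof.
apply/eqP => /(congr1 val) /= e; have il := ltn_ord i.
have [?|?] : i.+1 < n \/ i.+1 = n by lia.
  by move: e; rewrite modn_small //; lia.
by move: e; have -> : i.+1 = n by []; rewrite modnn; lia.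
Qed.

Lemma ordS_neq_ord_pred (i : 'I_n) : ordS i != ord_pred i.
Proof.
apply/eqP => e; have := congr1 (@ordS n) e; rewrite ord_predK.
move=> /(congr1 val) /=; rewrite -[(_ %% n).+1]addn1 modnDml addn1 => e2; have il := ltn_ord i.
have [?|?] : i.+2 < n \/ i.+2 = n + (i.+2 - n) by lia.
  by move: e2; rewrite modn_small //; lia.
move: e2; have -> : i.+2 = n + (i.+2 - n) by [].
by rewrite modnDl modn_small; lia.
Qed.

Lemma cycle_adjE (i j : 'I_n) :
  cycle_adj i j = (i == ordS j) || (i == ord_pred j).
Proof.
rewrite /cycle_adj.
have -> : (j == ordS i) = (i == ord_pred j).
  by apply/eqP/eqP => ->; rewrite ?ordSK ?ord_predK.
rewrite orbC; case: eqVneq => //= ->; symmetry; apply/negbTE.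
rewrite negb_or eq_sym ordS_neq /=.
by apply/eqP => e; have := ordS_neq (ord_pred j); rewrite ord_predK {1}e eqxx.
Qed.

End CycleNeighbours.

(** * Eigenvalue equations for the join *)

Section Spectrum.
Local Open Scope ring_scope.

(** Replaces row vectors indexed by ['I_#|G|] with functions on the vertices, so that the
    enumeration of [G] disappears. *)
Lemma eigenvalue_distanceP (G : sgraph) (a : algC) :
  eigenvalue (distance_matrix G) a <->
  exists2 f : G -> algC,
    forall y, \sum_x f x * (dist x y)%:R = a * f y & exists x, f x != 0.
Proof.
split=> [/eigenvalueP[v ve v0]|[f fe [x fx]]].
  exists (fun x => v 0 (enum_rank x)) => [y|]; last first.
    by have [i vi] := rV0Pn _ v0; exists (enum_val i); rewrite enum_valK.
  move/rowP/(_ (enum_rank y)): ve; rewrite !mxE => <-.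
  rewrite big_enum_val; apply: eq_bigr => i _.
  by rewrite !mxE enum_valK enum_rankK.
apply/eigenvalueP; exists (\row_i f (enum_val i)); last first.
  apply: contra_neq fx => /rowP/(_ (enum_rank x)).
  by rewrite !mxE enum_rankK.
apply/rowP => j; rewrite !mxE -fe [RHS]big_enum_val.
by apply: eq_bigr => i _; rewrite !mxE.
Qed.

Lemma sum_mul_delta (I : finType) (f : I -> algC) (c : I) :
  \sum_i f i * (i == c)%:R = f c.
Proof.
rewrite (bigD1 c) //= eqxx mulr1 big1 ?addr0 // => i /negbTE->.
by rewrite mulr0.
Qed.

(** Within a part all distances between distinct vertices are 2, except that the two neighbours on
    the cycle are at distance 1, hence the two subtracted terms. *)
Lemma eigenvalue_joinP (m n : nat) (a : algC) : (0 < m)%N -> (2 < n)%N ->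
  eigenvalue (distance_matrix (join_graph (edgeless_graph m) (cycle_graph n))) a
  <-> exists (f : 'I_m -> algC) (g : 'I_n -> algC),
    [/\ forall i, 2 * (\sum_k f k - f i) + \sum_k g k = a * f i,
        forall j, \sum_k f k + 2 * (\sum_k g k - g j)
                  - g (ordS j) - g (ord_pred j) = a * g j
      & (exists i, f i != 0) \/ (exists j, g j != 0)].
Proof.
move=> m0 n3; set G := join_graph _ _.
have dE (x y : G) :
    dist x y = if x == y then 0%N else if adj x y then 1%N else 2%N.
  by apply: dist_join; rewrite /= !card_ord; lia.
have sumE (h : G -> algC) : \sum_x h x = \sum_i h (inl i) + \sum_j h (inr j).
  exact: big_sumType.
have sumL (h : G -> algC) i :
    \sum_x h x * (dist x (inl i))%:R =
    2 * (\sum_k h (inl k) - h (inl i)) + \sum_k h (inr k).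
  rewrite sumE; congr (_ + _); last first.
    by apply: eq_bigr => k _; rewrite dE /= mulr1.
  (* Single values become sums against a delta, so that the two sides can be compared term by
     term. *)
  rewrite -[in RHS](sum_mul_delta (fun k => h (inl k)) i) -sumrB mulr_sumr.
  apply: eq_bigr => k _; rewrite dE /= /edgeless_adj.
  by rewrite (inj_eq (@inl_inj _ _)); case: eqP => _ /=; ring.
have sumR (h : G -> algC) j :
    \sum_x h x * (dist x (inr j))%:R =
    \sum_k h (inl k) + 2 * (\sum_k h (inr k) - h (inr j))
      - h (inr (ordS j)) - h (inr (ord_pred j)).
  rewrite sumE -!addrA; congr (_ + _).
    by apply: eq_bigr => k _; rewrite dE /= mulr1.
  pose hr k := h (inr k).
  rewrite -[h (inr (ord_pred j))](sum_mul_delta hr) -[h (inr (ordS j))](sum_mul_delta hr).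
  rewrite -[h (inr j)](sum_mul_delta hr) -!sumrB mulr_sumr -!sumrN -!big_split /=.
  apply: eq_bigr => k _; rewrite dE /= cycle_adjE // (inj_eq (@inr_inj _ _)).
  (* As [j] and its two neighbours are distinct, at most one delta is nonzero in each term. *)
  have nS : ordS j != j by rewrite ordS_neq.
  have nP : ord_pred j != j.
    by have := ordS_neq n3 (ord_pred j); rewrite ord_predK eq_sym.
  have nSP : ordS j != ord_pred j by rewrite ordS_neq_ord_pred.
  rewrite /hr; case: (eqVneq k j) => [->|_] /=.
    by rewrite ![j == _]eq_sym (negbTE nS) (negbTE nP) /=; ring.
  case: (eqVneq k (ordS j)) => [->|_] /=; first by rewrite (negbTE nSP) /=; ring.
  by case: (eqVneq k (ord_pred j)) => _ /=; ring.
split=> [/eigenvalue_distanceP[h he [x hx]]|[f [g [fe ge fg0]]]].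
  exists (fun i => h (inl i)), (fun j => h (inr j)); split.
  - by move=> i; rewrite -sumL he.
  - by move=> j; rewrite -sumR he.
  - by case: x hx => [i|j] hx; [left; exists i | right; exists j].
apply/eigenvalue_distanceP.
exists (fun x => match x with inl i => f i | inr j => g j end).
  by case=> [i|j]; rewrite ?sumL ?sumR.
by case: fg0 => [[i]|[j]]; [exists (inl i) | exists (inr j)].
Qed.

Lemma sum_ordS (n : nat) (g : 'I_n -> algC) : \sum_j g (ordS j) = \sum_j g j.
Proof. by rewrite [RHS](reindex_inj (@ordS_inj n)). Qed.

Lemma sum_ord_pred (n : nat) (g : 'I_n -> algC) :
  \sum_j g (ord_pred j) = \sum_j g j.
Proof. by rewrite [RHS](reindex_inj (can_inj (@ord_predK n))). Qed.

(** * Eigenvalues that always occur *)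

Lemma eigenvalue_quotient (m n : nat) (a : algC) : (0 < m)%N -> (2 < n)%N ->
    (a - (2 * m%:R - 2)) * (a - (2 * n%:R - 4)) = m%:R * n%:R ->
  eigenvalue (distance_matrix (join_graph (edgeless_graph m) (cycle_graph n))) a.
Proof.
move=> m0 n3 ae; apply/eigenvalue_joinP => //.
(* These constants solve the first equation identically; the second then becomes the quadratic. *)
exists (fun=> n%:R), (fun=> a - (2 * m%:R - 2)).
have sum_const k (c : algC) : \sum_(i < k) c = c * k%:R.
  by rewrite sumr_const card_ord mulr_natr.
rewrite !sum_const; split.
- by move=> _; ring.
- move=> _; apply/eqP; rewrite -subr_eq0; apply/eqP.
  transitivity (m%:R * n%:R - (a - (2 * m%:R - 2)) * (a - (2 * n%:R - 4))).
    by ring.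
  by rewrite ae subrr.
- by left; exists (Ordinal m0); rewrite pnatr_eq0; lia.
Qed.

Lemma eigenvalue_cycle_part (m n : nat) (z : algC) : (0 < m)%N -> (2 < n)%N ->
    n.-primitive_root z ->
  eigenvalue (distance_matrix (join_graph (edgeless_graph m) (cycle_graph n)))
    (- 2 - (z + z^-1)).
Proof.
move=> m0 n3 pz; apply/eigenvalue_joinP => //.
have zn := prim_expr_order pz.
have z0 : z != 0.
  apply: contra_eq_neq zn => ->.
  by rewrite expr0n eqn0Ngt (ltnW (ltnW n3)) eq_sym oner_eq0.
have z1 : z != 1.
  apply/eqP => z1; have := prim_order_dvd pz 1; rewrite expr1 z1 eqxx.
  by rewrite dvdn1; lia.
have gS (j : 'I_n) : z ^+ ordS j = z * z ^+ j.
  by rewrite /= (prim_expr_mod pz) exprS.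
have gP (j : 'I_n) : z ^+ ord_pred j = z^-1 * z ^+ j.
  by rewrite -{2}[j]ord_predK gS mulKf.
(* Shifting the index preserves the sum but multiplies it by [z], which is not 1. *)
have gs : \sum_(j < n) z ^+ j = 0.
  apply/eqP; have := sum_ordS (fun j : 'I_n => z ^+ j).
  under eq_bigr do rewrite gS.
  rewrite -mulr_sumr => /eqP; rewrite -subr_eq0 -{2}[\sum_i _]mul1r -mulrBl.
  by rewrite mulf_eq0 subr_eq0 (negbTE z1).
exists (fun=> 0), (fun j => z ^+ j); rewrite gs big1 //; split.
- by move=> _; ring.
- by move=> j; rewrite gS gP; ring.
- by right; exists (Ordinal (ltnW (ltnW n3))); rewrite expf_neq0.
Qed.

(* The sum is [2 cos (2 pi k / n)], so [n] is a crystallographic order. *)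
Lemma prim_root_sum_int (n : nat) (z : algC) : (2 < n)%N ->
  n.-primitive_root z -> z + z^-1 \is a Num.int -> n \in [:: 3; 4; 6]%N.
Proof.
move=> n3 pz /intrP[k ke].
have zn := prim_expr_order pz.
have nz : `|z| = 1.
  apply/eqP; rewrite -(@pexpr_eq1 _ _ n) ?normr_ge0 //; last by lia.
  by rewrite -normrX zn normr1.
have z0 : z != 0 by rewrite -normr_eq0 nz oner_eq0.
have kb : (`|k| <= 2)%R.
  have : `|k%:~R| <= 2%:~R :> algC.
    by rewrite -ke (le_trans (ler_normD _ _)) // normfV nz invr1.
  by rewrite -intr_norm ler_int.
have qe : z ^+ 2 - k%:~R * z + 1 = 0.
  by rewrite -ke; field.
have dvd d : z ^+ d = 1 -> (n %| d)%N.
  by move/eqP; rewrite -(prim_order_dvd pz).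
have sub346 d : d \in [:: 3; 4; 6]%N -> (n %| d)%N -> n \in [:: 3; 4; 6]%N.
  rewrite !inE => d6 nd; have nd' : (n <= d)%N by apply: dvdn_leq nd; lia.
  have n5 : n <> 5%N by move=> n5; move: nd; rewrite n5; lia.
  by lia.
have factor (p : algC) d :
    z ^+ d - 1 = p * (z ^+ 2 - k%:~R * z + 1) -> (n %| d)%N.
  by rewrite qe mulr0 => /eqP; rewrite subr_eq0 => /eqP/dvd.
(* Rules out [k = 2] and [k = -2], which would force [z] to be 1 or -1, of order at most 2. *)
have not2 : ~ (z ^+ 2 - 1) ^+ 2 = 0.
  move=> /eqP; rewrite sqrf_eq0 subr_eq0 => /eqP/dvd/dvdn_leq; lia.
have [ke'|[ke'|[ke'|[ke'|ke']]]] :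
    k = 2 \/ k = 1 \/ k = 0 \/ k = -1 \/ k = -2 by lia.
- case: not2; transitivity ((z + 1) ^+ 2 * (z ^+ 2 - k%:~R * z + 1)).
    by rewrite ke'; ring.
  by rewrite qe mulr0.
(* For [k] equal to 1, 0, -1 the quadratic is the cyclotomic polynomial of order 6, 4, 3; the factor
   supplied is its cofactor in [X^d - 1]. *)
- apply: (@sub346 6%N) => //.
  by apply: (factor ((z ^+ 3 - 1) * (z + 1))); rewrite ke'; ring.
- by apply: (@sub346 4%N) => //; apply: (factor (z ^+ 2 - 1)); rewrite ke'; ring.
- by apply: (@sub346 3%N) => //; apply: (factor (z - 1)); rewrite ke'; ring.
- case: not2; transitivity ((z - 1) ^+ 2 * (z ^+ 2 - k%:~R * z + 1)).
    by rewrite ke'; ring.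
  by rewrite qe mulr0.
Qed.

(** * Every eigenvalue is of one of three kinds *)

(** Summing the equations over each part gives a 2 by 2 linear system in the sums [S] and [T].
    Either its determinant vanishes, which is the quadratic, or [S = T = 0] and the equations for
    [f] and [g] decouple. *)
Lemma eigenvalue_join_cases (m n : nat) (a : algC) : (0 < m)%N -> (2 < n)%N ->
    eigenvalue (distance_matrix
      (join_graph (edgeless_graph m) (cycle_graph n))) a ->
  [\/ (a - (2 * m%:R - 2)) * (a - (2 * n%:R - 4)) = m%:R * n%:R,
      a = - 2
    | exists2 g : 'I_n -> algC,
        forall j, g (ordS j) + g (ord_pred j) = (- 2 - a) * g j
        & exists j, g j != 0].
Proof.
move=> m0 n3 /eigenvalue_joinP[] // f [g [fe ge fg0]].
set S := \sum_k f k in fe ge; set T := \sum_k g k in fe ge.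
have eS : (a - (2 * m%:R - 2)) * S = m%:R * T.
  have : a * S = 2 * (m%:R * S - S) + m%:R * T.
    rewrite [in LHS]/S mulr_sumr; under eq_bigr do rewrite -fe.
    rewrite big_split /= -mulr_sumr sumrB !sumr_const card_ord -/S.
    by rewrite -(mulr_natl S) -(mulr_natl T).
  by move=> e; rewrite mulrBl e; ring.
have eT : (a - (2 * n%:R - 4)) * T = n%:R * S.
  have : a * T = n%:R * S + 2 * (n%:R * T - T) - T - T.
    rewrite [in LHS]/T mulr_sumr; under eq_bigr do rewrite -ge.
    rewrite !sumrB big_split /= -mulr_sumr sumrB !sumr_const card_ord.
    by rewrite sum_ordS sum_ord_pred -/T -(mulr_natl S) -(mulr_natl T).
  by move=> e; rewrite mulrBl e; ring.
set q := (a - (2 * m%:R - 2)) * (a - (2 * n%:R - 4)).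
have [qe|qn] := eqVneq q (m%:R * n%:R); first by constructor 1.
have qS : (q - m%:R * n%:R) * S = 0.
  transitivity ((a - (2 * n%:R - 4)) * ((a - (2 * m%:R - 2)) * S)
                - m%:R * (n%:R * S)); first by rewrite /q; ring.
  by rewrite eS -eT; ring.
have qT : (q - m%:R * n%:R) * T = 0.
  transitivity ((a - (2 * m%:R - 2)) * ((a - (2 * n%:R - 4)) * T)
                - n%:R * (m%:R * T)); first by rewrite /q; ring.
  by rewrite eT -eS; ring.
move/eqP: qS; rewrite mulf_eq0 subr_eq0 (negbTE qn) /= => /eqP S0.
move/eqP: qT; rewrite mulf_eq0 subr_eq0 (negbTE qn) /= => /eqP T0.
case: fg0 => [[i fi]|g0].
  constructor 2; apply/eqP; rewrite -addr_eq0.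
  have : (a + 2) * f i == 0.
    by rewrite mulrDl -fe S0 T0; apply/eqP; ring.
  by rewrite mulf_eq0 (negbTE fi) orbF.
constructor 3; exists g => // j.
by rewrite mulrBl -ge S0 T0; ring.
Qed.

(** * Integrality for the listed pairs *)

(** Here [b] is an adjacency eigenvalue of the cycle. Walking around a short cycle closes up and
    yields a polynomial equation for [b] with only integer roots. *)
Lemma cycle_eigenvalue_int (n : nat) (b : algC) (g : 'I_n -> algC) :
    n \in [:: 3; 4; 6]%N ->
    (forall j, g (ordS j) + g (ord_pred j) = b * g j) ->
    (exists j, g j != 0) ->
  b \is a Num.int.
Proof.
move=> n346 ge [j0 gj0].
(* Chebyshev recursion: the eigenvalues of the second and third order
   neighbours are [b ^+ 2 - 2] and [b ^+ 3 - 3 * b]. *)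
have g2 j : g (ordS (ordS j)) + g (ord_pred (ord_pred j)) = (b ^+ 2 - 2) * g j.
  have := ge (ordS j); rewrite ordSK => eS.
  have := ge (ord_pred j); rewrite ord_predK => eP.
  transitivity (b * g (ordS j) + b * g (ord_pred j) - 2 * g j).
    by rewrite -eS -eP; ring.
  by rewrite -mulrDr ge; ring.
have g3 j : g (ordS (ordS (ordS j))) + g (ord_pred (ord_pred (ord_pred j))) =
    (b ^+ 3 - 3 * b) * g j.
  have := ge (ordS (ordS j)); rewrite ordSK => eS.
  have := ge (ord_pred (ord_pred j)); rewrite ord_predK => eP.
  transitivity (b * (g (ordS (ordS j)) + g (ord_pred (ord_pred j))) - b * g j).
    by rewrite mulrDr -eS -eP -ge; ring.
  by rewrite g2; ring.
have root (p : algC) : p * g j0 = 0 -> p == 0.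
  by move/eqP; rewrite mulf_eq0 (negbTE gj0) orbF.
move: n346; rewrite !inE => /or3P[] /eqP n_eq; subst n.
(* On the triangle second neighbours are first neighbours, so [b^2 - 2 = b]. *)
- have e : ordS (ordS j0) = ord_pred j0.
    by apply: val_inj; case: j0 {gj0 root} => -[|[|[|]]].
  have e' : ord_pred (ord_pred j0) = ordS j0.
    by apply: val_inj; case: j0 {gj0 root e} => -[|[|[|]]].
  have : (b - 2) * (b + 1) == 0.
    apply: root; transitivity ((b ^+ 2 - 2) * g j0 - b * g j0); first by ring.
    by rewrite -g2 -ge e e'; ring.
  rewrite mulf_eq0 subr_eq0 addr_eq0 => /orP[]/eqP->.
    exact: natr_int.
  by rewrite rpredN int_num1.
(* Two steps either way reach the antipode, and doing so twice returns to the start: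
   [(b^2 - 2)^2 = 4]. *)
- have e j : ord_pred (ord_pred j) = ordS (ordS j) :> 'I_4.
    by apply: val_inj; case: j => -[|[|[|[|]]]].
  have e4 : ordS (ordS (ordS (ordS j0))) = j0.
    by apply: val_inj; case: j0 {gj0 root} => -[|[|[|[|]]]].
  have : b ^+ 2 * (b - 2) * (b + 2) == 0.
    apply: root.
    transitivity ((b ^+ 2 - 2) * ((b ^+ 2 - 2) * g j0) - 4 * g j0); first by ring.
    have -> : (b ^+ 2 - 2) * g j0 = 2 * g (ordS (ordS j0)).
      by rewrite -g2 e; ring.
    by rewrite mulrCA -g2 e e4; ring.
  rewrite 2!mulf_eq0 sqrf_eq0 subr_eq0 addr_eq0 => /orP[/orP[]|]/eqP->.
  + exact: int_num0.
  + exact: natr_int.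
  + by rewrite rpredN natr_int.
(* The antipode is now three steps away: [(b^3 - 3 b)^2 = 4]. *)
- have e j : ord_pred (ord_pred (ord_pred j)) = ordS (ordS (ordS j)) :> 'I_6.
    by apply: val_inj; case: j => -[|[|[|[|[|[|]]]]]].
  have e6 : ordS (ordS (ordS (ordS (ordS (ordS j0))))) = j0.
    by apply: val_inj; case: j0 {gj0 root} => -[|[|[|[|[|[|]]]]]].
  have : (b - 1) ^+ 2 * (b + 1) ^+ 2 * (b - 2) * (b + 2) == 0.
    apply: root.
    transitivity ((b ^+ 3 - 3 * b) * ((b ^+ 3 - 3 * b) * g j0) - 4 * g j0).
      by ring.
    have -> : (b ^+ 3 - 3 * b) * g j0 = 2 * g (ordS (ordS (ordS j0))).
      by rewrite -g3 e; ring.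
    by rewrite mulrCA -g3 e e6; ring.
  rewrite 3!mulf_eq0 !sqrf_eq0 !subr_eq0 !addr_eq0.
  case/orP=> [/orP[/orP[]|]|]/eqP->; rewrite ?rpredN ?int_num1 ?natr_int //.
Qed.

Lemma quotient_eigenvalue_int (m n : nat) (a : algC) :
    (m, n) \in [:: (1, 3); (4, 3); (2, 4); (4, 6); (12, 6)]%N ->
    (a - (2 * m%:R - 2)) * (a - (2 * n%:R - 4)) = m%:R * n%:R ->
  a \is a Num.int.
Proof.
rewrite !inE !xpair_eqE => mn ae.
have factor (x y : int) :
    (a - x%:~R) * (a - y%:~R) =
      (a - (2 * m%:R - 2)) * (a - (2 * n%:R - 4)) - m%:R * n%:R ->
    a \is a Num.int.
  rewrite ae subrr => /eqP; rewrite mulf_eq0 !subr_eq0.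
  by case/orP=> /eqP->; apply: intr_int.
case/or4P: mn => [|||/orP[]] /andP[/eqP em /eqP en]; subst m n.
(* The integers supplied are the roots [m + n - 3 +- t], with [t] equal to 2, 4, 3, 5, 11 in
   turn. *)
- by apply: (factor 3 (-1)); ring.
- by apply: (factor 8 0); ring.
- by apply: (factor 6 0); ring.
- by apply: (factor 2 12); ring.
- by apply: (factor 4 26); ring.
Qed.

(** * Arithmetic conditions on [m] and [n] *)

(* The quotient eigenvalues are [m + n - 3 +- sqrt ((m - n + 1)^2 + m n)]. *)
Lemma quotient_int_square (m n : nat) : (0 < m)%N -> (0 < n)%N ->
    (forall a : algC,
       (a - (2 * m%:R - 2)) * (a - (2 * n%:R - 4)) = m%:R * n%:R ->
       a \is a Num.int) ->
  exists t : nat, (t%:Z ^+ 2 = (m%:Z - n%:Z + 1) ^+ 2 + m%:Z * n%:Z)%R.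
Proof.
move=> m0 n0 qi; pose N : int := (m%:Z - n%:Z + 1) ^+ 2 + m%:Z * n%:Z.
have N0 : 0 <= N by rewrite addr_ge0 ?sqr_ge0.
pose s : algC := sqrtC N%:~R.
have sE : s ^+ 2 = (m%:R - n%:R + 1) ^+ 2 + m%:R * n%:R.
  by rewrite sqrtCK /N; ring.
have : m%:R + n%:R - 3 + s \is a Num.int.
  apply: qi; transitivity (s ^+ 2 - (m%:R - n%:R + 1) ^+ 2); first by ring.
  by rewrite sE; ring.
rewrite rpredDl => [sint|]; last by rewrite -natrD rpredB ?natr_int.
(* The square root [sqrtC] of a nonnegative number is nonnegative, so [s] is a natural number once
   it is an integer. *)
have : s \is a Num.nat by rewrite natrEint sint sqrtC_ge0 ler0z.
case/natrP=> t te; exists t; apply: (@intr_inj algC).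
have : (t%:R : algC) ^+ 2 = N%:~R by rewrite -te sqrtCK.
by rewrite rmorphXn.
Qed.

End Spectrum.

(* Comparing [t] with [m] bounds [m], since [t ^+ 2 - m ^+ 2] is linear in [m]. *)
Lemma discriminant_square (m n t : nat) : 0 < m -> n \in [:: 3; 4; 6] ->
    (t%:Z ^+ 2 = (m%:Z - n%:Z + 1) ^+ 2 + m%:Z * n%:Z)%R ->
  (m, n) \in [:: (1, 3); (4, 3); (2, 4); (4, 6); (12, 6)].
Proof.
move=> m0; rewrite !inE !xpair_eqE => /or3P[] /eqP-> te.
(* Here [t^2 = m^2 - m + 4]: [t < m] is impossible, [t = m] gives 4, and [t > m] forces [m <= 1]. *)
- have : m = 1 \/ m = 4.
    by case: (ltngtP t m) => ?; nia.
  by lia.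
(* Here [t^2 = m^2 - 2 m + 9]: only [t > m] is possible, and it forces [m <= 2]. *)
- have : m = 2.
    case: (ltngtP t m) => ?; try by nia.
    have ? : m <= 2 by nia.
    have ? : t <= 3 by nia.
    have tE : t = 3 \/ t = 2 \/ t = 1 \/ t = 0 by lia.
    by case: tE => [?|[?|[?|?]]]; subst; nia.
  by lia.
(* Here [t^2 = m^2 - 4 m + 25]: for [t <= m] only [t = m - 1] survives and gives 12, while [t > m]
   forces [m <= 4]. *)
- have : m = 4 \/ m = 12.
    have [?|[?|[?|?]]] : t.+1 < m \/ t.+1 = m \/ t = m \/ m < t by lia.
    1-3: by nia.
    have ? : m <= 4 by nia.
    (* Since [t^2 = (m - 2)^2 + 21] exceeds 16, [t] is at least 5, which forces [m >= 4]. *)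
    by case: (leqP t 4) => ?; nia.
  by lia.
Qed.

Theorem theorem1 (m n : nat) (hm : 1 <= m) (hn : 3 <= n) :
  D_integral (join_graph (edgeless_graph m) (cycle_graph n)) <->
  (m, n) \in [:: (1, 3); (4, 3); (2, 4); (4, 6); (12, 6)].
Proof.
split=> [int_eig|mn a].
  have n346 : n \in [:: 3; 4; 6].
    have [z pz] := C_prim_root_exists (ltnW (ltnW hn)).
    apply: (prim_root_sum_int hn pz).
    have := int_eig _ (eigenvalue_cycle_part hm hn pz).
    by rewrite rpredBl ?rpredN ?natr_int.
  have [t te] : exists t : nat,
      (t%:Z ^+ 2 = (m%:Z - n%:Z + 1) ^+ 2 + m%:Z * n%:Z)%R.
    apply: quotient_int_square => // [|a ae]; first by lia.
    exact/int_eig/eigenvalue_quotient.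
  exact: discriminant_square hm n346 te.
case/eigenvalue_join_cases=> // [ae|->|[g ge g0]].
- exact: quotient_eigenvalue_int mn ae.
- by rewrite rpredN natr_int.
have n346 : n \in [:: 3; 4; 6].
  by move: mn; rewrite !inE !xpair_eqE; lia.
have := cycle_eigenvalue_int n346 ge g0.
by rewrite rpredBl ?rpredN ?natr_int.
Qed.
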